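(* Let $A=\mathbb{R}[X,Y]/(X^2+Y^2-1)$, and let $x,y\in A$ be the classes of $X$ and $Y$. Consider the $A$-linear map $Q:A^2\to A^2$ with matrix $$Q=\frac12\begin{pmatrix}1+x & y\\ y & 1-x\end{pmatrix},$$ let $M=\operatorname{Im}(Q)\subset A^2$, and let $I=(1+x)A+yA\subset A$. Then the first projection $\mathrm{pr}_1:A^2\to A$ induces an isomorphism of $A$-modules from $M$ onto $I$. *)

(* Defs.v *)
From HB Require Import structures.
From mathcomp Require Import all_boot all_order all_algebra.
From mathcomp Require Import boolp reals.
From mathcomp.multinomials Require Import mpoly.

Set Implicit Arguments.
Unset Strict Implicit.
Unset Printing Implicit Defensive.

Import GRing.Theory.
Local Open Scope ring_scope.

Section CircleRing.
Variable R : realType.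

Definition polyX : {mpoly R[2]} := 'X_(0 : 'I_2).
Definition polyY : {mpoly R[2]} := 'X_(1 : 'I_2).

Definition circle_poly : {mpoly R[2]} := polyX ^+ 2 + polyY ^+ 2 - 1.

Definition circle_ideal : {pred {mpoly R[2]}} :=
  fun p => `[< exists q, p = circle_poly * q >].

Lemma circle_ideal_closed : idealr_closed circle_ideal.
Proof.
split.
- by apply/asboolP; exists 0; rewrite mulr0.
- apply/asboolP => -[q /(congr1 (meval (fun i : 'I_2 => (i == 0)%:R)))].
  rewrite mevalM mevalB mevalD !rmorphXn /= !mevalXU rmorph1 /=.
  rewrite expr1n expr0n addr0 subrr mul0r => /eqP.
  by rewrite oner_eq0.
- move=> a p1 p2 /asboolP[q1 ->] /asboolP[q2 ->]; apply/asboolP.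
  by exists (a * q1 + q2); rewrite mulrDr mulrCA.
Qed.

HB.instance Definition _ :=
  isIdealr.Build {mpoly R[2]} circle_ideal circle_ideal_closed.

Definition circle_ring : comNzRingType := {ideal_quot circle_ideal}.

Definition circle_class (p : {mpoly R[2]}) : circle_ring :=
  (\pi_{ideal_quot circle_ideal} p)%qT.

Definition circle_x : circle_ring := circle_class polyX.
Definition circle_y : circle_ring := circle_class polyY.

(* The scalar 1/2 of the real algebra circle_ring: {ideal_quot _} carries only
   a ring structure, so real scalars enter as classes of constants. *)
Definition circle_half : circle_ring := circle_class (2^-1)%:MP.

Definition Qmx : 'M[circle_ring]_2 :=
  circle_half *: \matrix_(i, j)
    nth 0 (nth [::] [:: [:: 1 + circle_x; circle_y     ];
                        [:: circle_y;     1 - circle_x ]] i) j.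

Definition Qmap : {linear 'cV[circle_ring]_2 -> 'cV[circle_ring]_2} :=
  mulmx Qmx.

End CircleRing.

Section Image.
Variables (A : comNzRingType) (U V : lmodType A) (f : {linear U -> V}).

Definition in_image : {pred V} := fun v => `[< exists u, v = f u >].

Lemma in_image_submod_closed : submod_closed in_image.
Proof.
split; first by apply/asboolP; exists 0; rewrite raddf0.
move=> a _ _ /asboolP[u1 ->] /asboolP[u2 ->]; apply/asboolP.
by exists (a *: u1 + u2); rewrite linearP.
Qed.

HB.instance Definition _ :=
  GRing.isSubmodClosed.Build A V in_image in_image_submod_closed.

Record image_module := ImageModule {
  image_val :> V;
  _ : image_val \in in_image
}.

HB.instance Definition _ := [isSub for image_val].
HB.instance Definition _ := [Choice of image_module by <:].
HB.instance Definition _ := [SubChoice_isSubLmodule of image_module by <:].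

End Image.

Section TwoGenerators.
Variables (A : comNzRingType) (a b : A).

Definition in_ideal2 : {pred A^o} :=
  fun c => `[< exists u v : A, c = a * u + b * v >].

Lemma in_ideal2_submod_closed : submod_closed in_ideal2.
Proof.
split; first by apply/asboolP; exists 0, 0; rewrite !mulr0 addr0.
move=> c _ _ /asboolP[u1 [v1 ->]] /asboolP[u2 [v2 ->]]; apply/asboolP.
exists (c * u1 + u2), (c * v1 + v2).
rewrite /GRing.scale /= !mulrDr !(mulrCA c) -!addrA; congr (_ + _).
by rewrite addrCA.
Qed.

HB.instance Definition _ :=
  GRing.isSubmodClosed.Build A A^o in_ideal2 in_ideal2_submod_closed.

(* The ideal aA + bA as an A-module: a submodule of the regular module A^o. *)
Record ideal2 := Ideal2 {
  ideal2_val :> A^o;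
  _ : ideal2_val \in in_ideal2
}.

HB.instance Definition _ := [isSub for ideal2_val].
HB.instance Definition _ := [Choice of ideal2 by <:].
HB.instance Definition _ := [SubChoice_isSubLmodule of ideal2 by <:].

End TwoGenerators.

Definition pr1 (A : comNzRingType) (v : 'cV[A]_2) : A := v 0 0.

(* Main.v *)
Require Import Defs.
From HB Require Import structures.
From mathcomp Require Import all_boot all_order all_algebra.
From mathcomp Require Import boolp reals ring.
From mathcomp.multinomials Require Import mpoly.

(** Since [y * row2 = (1 - x) * row1] in [2 Q], a vector [(0, s)] of [M] satisfies
    [y s = 0], so injectivity amounts to [y] not being a zero divisor in [A].
    If [Y p = (X^2 + Y^2 - 1) q], setting [Y = 0] gives [(X^2 - 1) q(X, 0) = 0],
    hence [Y] divides [q] and can be cancelled. Surjectivity holds because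
    [Q (2u, 2v)] has first coordinate [(1 + x) u + y v]. *)

Import GRing.Theory.
Local Open Scope ring_scope.

Section CircleRingTheory.
Variable R : realType.

Notation X := (Defs.polyX R).
Notation Y := (Defs.polyY R).

Lemma circle_classD p q :
  circle_class (p + q) = circle_class p + circle_class q :> circle_ring R.
Proof. exact: rmorphD. Qed.

Lemma circle_classM p q :
  circle_class (p * q) = circle_class p * circle_class q :> circle_ring R.
Proof. exact: rmorphM. Qed.

Lemma circle_class1 : circle_class 1 = 1 :> circle_ring R.
Proof. exact: rmorph1. Qed.

(** Moves questions about A back to divisibility in R[X, Y], where cancellation is available because
    it is a domain. *)
Lemma circle_class_eq0 p :
  circle_class p = 0 :> circle_ring R <-> exists q, p = circle_poly R * q.
Proof.
have -> : 0 = circle_class 0 :> circle_ring R by rewrite /circle_class rmorph0.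
split.
- by move=> /eqP; rewrite /circle_class -Quotient.idealrBE subr0 => /asboolP.
- by move=> h; apply/eqP; rewrite /circle_class -Quotient.idealrBE subr0;
  apply/asboolP.
Qed.

(** The additive form of 2 * (1/2) = 1, used to cancel the scalar in front of Q when preimages are
    built. *)
Lemma circle_half_double : circle_half R + circle_half R = 1.
Proof.
rewrite -circle_classD -mpolyCD -circle_class1; congr (circle_class _%:MP).
by rewrite -mulr2n -[_ *+ 2]mulr_natl divff // Num.Theory.pnatr_eq0.
Qed.

Lemma circle_eq : circle_x R * circle_x R + circle_y R * circle_y R = 1.
Proof.
apply/eqP; rewrite -subr_eq0 -!circle_classM -circle_classD -circle_class1.
apply/eqP; rewrite -[_ - _]rmorphB /=.
by apply/circle_class_eq0; exists 1; rewrite mulr1 /circle_poly !expr2.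
Qed.

(** The substitution Y = 0, kept as an endomorphism of R[X, Y] instead of a map to R[X], so that [p]
    and p(X, 0) lie in the same ring. *)
Definition restrict_axis : {mpoly R[2]} -> {mpoly R[2]} :=
  comp_mpoly [tuple X; 0].

Lemma restrict_axis_polyX : restrict_axis X = X.
Proof. by rewrite /restrict_axis comp_mpolyXU. Qed.

Lemma restrict_axis_polyY : restrict_axis Y = 0.
Proof. by rewrite /restrict_axis comp_mpolyXU. Qed.

(** Restriction is linear, so the claim reduces to monomials by induction on [p]. *)
Lemma restrict_axisP p : exists r, p = restrict_axis p + Y * r.
Proof.
elim/mpolyind: p => [|c m p _ _ [r hr]].
  by exists 0; rewrite /restrict_axis comp_mpoly0 mulr0 addr0.
have [s hs] : exists s, 'X_[m] = restrict_axis 'X_[m] + Y * s.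
  rewrite mpolyXE_id big_ord_recl big_ord1 /=.
  have -> : lift ord0 ord0 = 1 :> 'I_2 by apply: val_inj.
  rewrite -[ord0]/(0 : 'I_2) -/X -/Y /restrict_axis rmorphM !rmorphXn /=.
  rewrite -!/(restrict_axis _) restrict_axis_polyX restrict_axis_polyY.
  (* [m 1] is the exponent of Y: if it is 0 the monomial is fixed by the restriction; otherwise the
     monomial restricts to 0 and one factor Y splits off. *)
  case: (m 1) => [|k]; first by exists 0; rewrite !expr0 mulr0 addr0.
  by exists (X ^+ m 0 * Y ^+ k); rewrite expr0n mulr0 add0r mulrCA exprS.
exists (c *: s + r).
rewrite /restrict_axis comp_mpolyD comp_mpolyZ -!/(restrict_axis _).
by rewrite {1}hs {1}hr scalerDr mulrDr scalerAr addrACA.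
Qed.

Lemma circle_y_reg a : circle_y R * a = 0 -> a = 0.
Proof.
have Y0 : Y != 0.
  apply/eqP => /(congr1 (meval (fun=> 1))) /eqP.
  by rewrite /Defs.polyY mevalXU meval0 oner_eq0.
have X0 : X ^+ 2 - 1 != 0.
  apply/eqP => /(congr1 (meval (fun=> 0))) /eqP.
  rewrite mevalB rmorphXn /= mevalXU rmorph1 /= meval0 expr0n sub0r.
  by rewrite oppr_eq0 oner_eq0.
elim/quotW: a => p; rewrite -/(circle_class p) -circle_classM.
move=> /circle_class_eq0[q hq]; apply/circle_class_eq0.
have [r hr] := restrict_axisP q.
have q0 : restrict_axis q = 0.
  have /eqP := congr1 restrict_axis hq.
  rewrite /restrict_axis !rmorphM /= rmorphB rmorphD !rmorphXn rmorph1 /=.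
  rewrite -!/(restrict_axis _) restrict_axis_polyX restrict_axis_polyY.
  rewrite mul0r expr0n addr0 eq_sym mulf_eq0 (negPf X0) /=.
  by move/eqP.
(* Now [q] equals [Y * r], so both sides of [hq] carry a factor Y, which cancels in the domain
   R[X, Y]. *)
exists r; apply: (mulfI Y0).
by rewrite hq hr q0 add0r mulrCA.
Qed.

Lemma Qmap_coord0 v : Qmap R v 0 0 =
  circle_half R * ((1 + circle_x R) * v 0 0 + circle_y R * v 1 0).
Proof.
rewrite /Qmap /= mxE !big_ord_recl big_ord0 addr0 !mxE /= -!mulrA -mulrDr.
by congr (_ * (_ + _ * v _ _)); apply: val_inj.
Qed.

Lemma Qmap_coord1 v : Qmap R v 1 0 =
  circle_half R * (circle_y R * v 0 0 + (1 - circle_x R) * v 1 0).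
Proof.
rewrite /Qmap /= mxE !big_ord_recl big_ord0 addr0 !mxE /= -!mulrA -mulrDr.
by congr (_ * (_ + _ * v _ _)); apply: val_inj.
Qed.

Lemma Qmap_eq0 v : Qmap R v 0 0 = 0 -> Qmap R v = 0.
Proof.
move=> h0.
have h1 : Qmap R v 1 0 = 0.
  apply: circle_y_reg; rewrite Qmap_coord1.
  move: h0 circle_eq; rewrite Qmap_coord0.
  move: (circle_x R) (circle_y R) (circle_half R) (v 0 0) (v 1 0).
  move=> x y h a b h0 hxy.
  (* The relation between the rows holds only on the circle; the explicit multiple of x^2 + y^2 - 1
     makes it an identity in free variables, within reach of [ring]. *)
  have -> : y * (h * (y * a + (1 - x) * b)) =
    (1 - x) * (h * ((1 + x) * a + y * b)) + h * a * (x * x + y * y - 1) by ring.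
  by rewrite h0 hxy subrr !mulr0 addr0.
apply/colP => i; rewrite [RHS]mxE; case: i => [[|[|//]]] hi.
- by rewrite -[RHS]h0; congr (Qmap R v _ _); apply: val_inj.
- by rewrite -[RHS]h1; congr (Qmap R v _ _); apply: val_inj.
Qed.

End CircleRingTheory.

Theorem mainTheorem3 (R : realType) :
  exists phi : {linear image_module (Qmap R) ->
                       ideal2 (1 + circle_x R) (circle_y R)},
    (forall m : image_module (Qmap R), val (phi m) = pr1 (val m)) /\
    bijective phi.
Proof.
have pr1_in (m : image_module (Qmap R)) :
    pr1 (val m) \in in_ideal2 (1 + circle_x R) (circle_y R).
  case: m => v /= /asboolP[u ->]; apply/asboolP.
  (* The scalar 1/2 of Q is absorbed into the two coefficients. *)
  exists (circle_half R * u 0 0), (circle_half R * u 1 0).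
  by rewrite /pr1 Qmap_coord0 mulrDr !(mulrCA (circle_half R)).
pose phi m := Ideal2 (pr1_in m).
have phi_lin : linear phi.
  move=> a m n; apply: val_inj; rewrite linearP /= /pr1.
  by rewrite !mxE.
pose phiM := GRing.isLinear.Build _ _ _ _ phi phi_lin.
pose phiL : {linear image_module (Qmap R) ->
    ideal2 (1 + circle_x R) (circle_y R)} := HB.pack phi phiM.
exists phiL; split=> //.
have phi_inj : injective phiL.
  (* By additivity only the kernel matters, and each of its elements has the form Q u with first
     coordinate 0. *)
  apply: raddf_inj => m /(congr1 val) m0.
  apply: val_inj; rewrite raddf0; move: m0; rewrite /pr1.
  by case: m => v /= /asboolP[u ->]; apply: Qmap_eq0.
have phi_surj c : exists m, phiL m = c.
  case: c => c hc; have /asboolP[u [v huv]] := hc.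
  pose w : 'cV[circle_ring R]_2 :=
    \col_i (if i == 0 then u + u else v + v).
  have hw : Qmap R w \in in_image (Qmap R) by apply/asboolP; exists w.
  exists (ImageModule hw); apply: val_inj => /=; rewrite /pr1 Qmap_coord0 huv.
  rewrite !mxE /=; move: (circle_half_double R).
  move: (circle_half R) (1 + circle_x R) (circle_y R) => h a y hh.
  have -> : h * (a * (u + u) + y * (v + v)) = (h + h) * (a * u + y * v) by ring.
  by rewrite hh mul1r.
(* Choosing preimages gives a right inverse [g]; injectivity makes it a left inverse as well. *)
have [g hg] := choice phi_surj.
by exists g => // m; apply: phi_inj; rewrite hg.
Qed.
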